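(* Let $h\ge 0$ and let $(G,D)$ be a finite $3$-transposition group of type $3^{\bullet h}{:}\operatorname{Sym}(2)$. Then the diagram of $(G,D)$ has size $n=3^h$ and spectrum $$((\,3^h-1;\ [-1]^{3^h-1}\,)).$$
   Context: A $3$-transposition group $(G,D)$ is a group $G$ generated by a conjugacy class $D$ of elements of order $2$ such that $|de|\in\{1,2,3\}$ for all $d,e\in D$. Its diagram is the graph with vertex set $D$ in which $d$ and $e$ are adjacent iff $|de|=3$; its size is $n=|D|$. The spectrum is that of the $(0,1)$-adjacency matrix, written $((k;\dots,[r]^c,\dots))$: first the degree $k$ of the (regular) diagram, counted once, then the remaining eigenvalues, $[r]^c$ meaning $r$ with multiplicity $c$. $(G,D)$ has type $3^{\bullet h}{:}\operatorname{Sym}(2)$ if $G$ has a normal $3$-subgroup $N$ with $|D\cap dN|=3^h$ for all $d\in D$ and $G/N\cong \operatorname{Sym}(2)$ (the group of order $2$), generated by the image of $D$. *)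

(* Defs.v *)
From HB Require Import structures.
From mathcomp Require Import all_boot all_order all_fingroup all_algebra.
From mathcomp Require Import all_solvable all_field.

Set Implicit Arguments.
Unset Strict Implicit.
Unset Printing Implicit Defensive.

Import GroupScope GRing.Theory.

Definition three_transposition_group (gT : finGroupType)
    (G : {group gT}) (D : {set gT}) : Prop :=
  [/\ D \in classes G,
      <<D>> = G,
      {in D, forall d, #[d] = 2} &
      {in D &, forall d e, #[d * e] \in [:: 1; 2; 3]%N}].

Definition type_3h_Sym2 (gT : finGroupType) (h : nat)
    (G : {group gT}) (D : {set gT}) : Prop :=
  exists N : {group gT},
    [/\ N <| G,
        3.-group N,
        {in D, forall d, #|D :&: d *: N| = (3 ^ h)%N},
        G / N \isog [set: 'S_2] &
        <<D / N>> = G / N].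

Definition diagram_edge (gT : finGroupType) : rel gT :=
  fun d e => #[d * e] == 3.

Definition diagram_adjacency (gT : finGroupType) (D : {set gT}) :
    'M[algC]_#|D| :=
  (\matrix_(i, j) (diagram_edge (enum_val i) (enum_val j))%:R)%R.

(* [diagram_spectrum D k [:: (r1, c1); ...]] reads ((k; [r1]^c1, ...)): the
   diagram on D is k-regular, and its eigenvalues, with algebraic multiplicity,
   are k (once) together with each ri repeated ci times. *)
Definition diagram_spectrum (gT : finGroupType) (D : {set gT})
    (k : nat) (rs : seq (algC * nat)) : Prop :=
  {in D, forall d, #|[set e in D | diagram_edge d e]| = k} /\
  (char_poly (diagram_adjacency D) =
     ('X - (k%:R)%:P) * \prod_(rc <- rs) ('X - rc.1%:P) ^+ rc.2)%R.

(* Main.v *)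
(* Since G / N has order 2 it is abelian, so the class D lies in one coset of N
   and #|D| = 3 ^ h. For distinct d, e in D the product d * e is a nontrivial
   element of the 3-group N, hence has order 3: the diagram is complete, and its
   adjacency matrix is the all-ones matrix minus the identity. *)
Require Import Defs.
From HB Require Import structures.
From mathcomp Require Import all_boot all_order all_fingroup all_algebra.
From mathcomp Require Import all_solvable all_field.

Set Implicit Arguments.
Unset Strict Implicit.
Unset Printing Implicit Defensive.

Import GroupScope GRing.Theory.

(** All rows have the same sum [y - m.+1%:R], so two unipotent operations bring the matrix to block
    triangular form; writing the size as [1 + m] splits off the first row and column. *)
Lemma det_scalar_mx_sub_const1 (R : comNzRingType) (m : nat) (y : R) :
  (\det (y%:M - const_mx 1 : 'M_(1 + m)) = (y - m.+1%:R) * y ^+ m)%R.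
Proof.
pose c : 'cV[R]_m := const_mx 1%R; pose r : 'rV[R]_m := const_mx 1%R.
(* Left multiplication by [L] subtracts the first row from all others; right multiplication by [U]
   replaces the first column by the row sums. *)
pose L : 'M_(1 + m) := block_mx 1%:M 0%R (- c)%R 1%:M.
pose U : 'M_(1 + m) := block_mx 1%:M 0%R c 1%:M.
have detL : (\det L = 1)%R by rewrite det_lblock !det1 mulr1.
have detU : (\det U = 1)%R by rewrite det_lblock !det1 mulr1.
have cr1 : (c *m r = const_mx 1)%R.
  by apply/matrixP=> i j; rewrite !mxE big_ord1 !mxE mulr1.
have c1 : (c *m (const_mx 1 : 'M_1) = c)%R.
  by apply/matrixP=> i j; rewrite !mxE big_ord1 !mxE mulr1.
have rc1 : (r *m c = (m%:R)%:M)%R.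
  apply/matrixP=> i j; rewrite !mxE !ord1 eqxx mulr1n.
  under eq_bigr do rewrite !mxE mulr1.
  by rewrite sumr_const card_ord.
have one1 : (const_mx 1 = 1%:M :> 'M[R]_1)%R.
  by apply/matrixP=> i j; rewrite !mxE !ord1 eqxx.
have LMU : (L *m (y%:M - const_mx 1) *m U
    = block_mx (y - m.+1%:R)%:M (- r) 0 y%:M)%R.
  rewrite (scalar_mx_block 1 m) -(@block_mx_const _ 1 m 1 m).
  rewrite opp_block_mx add_block_mx.
  rewrite !mulmx_block !mul1mx !mul0mx !mulmx1 !mulmx0 !addr0 !add0r.
  rewrite !mulNmx !mulmxN opprK mulmxBr c1 cr1 addrC.
  have -> : (const_mx 1 + (y%:M - const_mx 1) = y%:M :> 'M_m)%R.
    by rewrite addrC subrK.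
  rewrite rc1 one1 mul_mx_scalar mul_scalar_mx.
  congr block_mx; last by rewrite opprB -/c addrAC subrK subrr.
  by rewrite addrC -addrA -opprD -raddfD /= nat1r -raddfB.
have := congr1 determinant LMU.
by rewrite !det_mulmx detL detU mul1r mulr1 det_ublock !det_scalar expr1.
Qed.

(** Here [A] is J - I with J all ones, so XI - A = (X + 1)I - J and the previous determinant applies
    at [y := 'X + 1]. At [n = 0] the truncated [n - 1] would give 'X instead of 1. *)
Lemma char_poly_complete_graph (R : comNzRingType) (n : nat) (A : 'M[R]_n) :
    (0 < n)%N -> (forall i j, A i j = (i != j)%:R)%R ->
  (char_poly A = ('X - (n - 1)%:R%:P) * ('X - (-1)%:P) ^+ (n - 1))%R.
Proof.
case: n A => // m A _ AE; rewrite subn1 /= polyCN opprK.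
have -> : (char_poly A = \det (('X + 1)%:M - const_mx 1 : 'M_(1 + m)))%R.
  congr (\det _)%R; apply/matrixP=> i j; rewrite !mxE AE.
  by case: eqP => _ /=; rewrite ?mulr1n ?mulr0n ?subr0 ?addrK.
rewrite det_scalar_mx_sub_const1; congr (_ * _)%R.
by rewrite -natr1 opprD addrACA subrr addr0 polyC_natr.
Qed.

Theorem theorem6p1 (gT : finGroupType) (h : nat)
    (G : {group gT}) (D : {set gT}) :
  three_transposition_group G D ->
  type_3h_Sym2 h G D ->
  #|D| = (3 ^ h)%N /\
  diagram_spectrum D (3 ^ h - 1)%N [:: ((-1)%R, (3 ^ h - 1)%N)].
Proof.
case=> /imsetP[d0 Gd0 DE] _ D2 D123 [N [nNG pN cardDN isoGN _]].
have Dd0 : d0 \in D by rewrite DE class_refl.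
have cGN : abelian (G / N).
  apply: cyclic_abelian; apply: prime_cyclic.
  by rewrite (card_isog isoGN) cardsT card_Sn.
have sub d : d \in D -> d0^-1 * d \in N.
  (* For d = d0 ^ g the quotient is the commutator [d0, g], which lies in the derived subgroup,
     hence in [N]. *)
  rewrite DE => /imsetP[g Gg ->]; rewrite -/(commg d0 g).
  have := der1_min (normal_norm nNG) cGN.
  by move/subsetP; apply; apply: mem_commg.
have subN d e : d \in D -> e \in D -> d * e \in N.
  move=> Dd De; have dV : d = d^-1 by apply/esym/invg2id/D2.
  (* As d is an involution, d e = (d0^-1 d)^-1 (d0^-1 e). *)
  rewrite dV -(mulKVg d0 e) mulgA groupM ?sub //.
  by rewrite -groupV invMg invgK sub.
have edgeE d e : d \in D -> e \in D -> diagram_edge d e = (d != e).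
  move=> Dd De; have dV : d^-1 = d by apply/invg2id/D2.
  rewrite /diagram_edge; have [<-|ne] := eqVneq d e.
    by rewrite -{1}dV mulVg order1.
  have := D123 d e Dd De; rewrite !inE => /or3P[|/eqP o2|->] //.
    by rewrite order_eq1 -{1}dV -eq_mulVg1 (negPf ne).
  (* Order 2 is impossible for an element of a 3-group. *)
  by have := mem_p_elt pN (subN d e Dd De); rewrite /p_elt o2.
have cardD : #|D| = (3 ^ h)%N.
  rewrite -(cardDN d0 Dd0); congr #|pred_of_set _|; apply/esym/setIidPl.
  by apply/subsetP=> d Dd; rewrite mem_lcoset sub.
split=> //; split.
  move=> d Dd; rewrite -cardD (cardsD1 d D) Dd addKn; apply: eq_card => e.
  rewrite !inE andbC; case De: (e \in D); rewrite ?andbF //=.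
  by rewrite edgeE // eq_sym !andbT.
rewrite big_seq1 /= -cardD; apply: char_poly_complete_graph.
  by rewrite cardD expn_gt0.
move=> i j; rewrite mxE edgeE ?enum_valP //.
by rewrite (inj_eq enum_val_inj).
Qed.
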